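(* Let $f:\mathbb{R}^n\times\mathbb{R}\to\mathbb{R}^n$ be $C^1$, let $\lambda_-<\lambda_+$, let $\Lambda$ be a parameter shift from $\lambda_-$ to $\lambda_+$, and let $r>0$. Let $\Phi$ be the solution cocycle of $\dot x=f(x,\Lambda(rt))$ and $\phi_-$ the flow of the past limit system $\dot x=f(x,\lambda_-)$. Suppose that $A_-$ is an asymptotically stable attractor for $\phi_-$. Then there is a local pullback attractor $\mathcal{A}$ of $\dot x=f(x,\Lambda(rt))$ whose upper backward limit $A_{-\infty}$ is contained in $A_-$.
   Context: A parameter shift from $\lambda_-$ to $\lambda_+$ is a smooth $\Lambda:\mathbb{R}\to(\lambda_-,\lambda_+)$ with $\lim_{\tau\to\pm\infty}\Lambda(\tau)=\lambda_\pm$ and $\lim_{\tau\to\pm\infty}\Lambda'(\tau)=0$. Solutions are assumed to exist for all time; $\Phi(t,s,x_0)$ is the value at time $t$ of the solution with $x(s)=x_0$. For nonempty compact $X,Y\subset\mathbb{R}^n$, $d(X,Y)=\sup_{x\in X}\inf_{y\in Y}\|x-y\|$, and $\mathcal{N}_\eta(M)=\{x: d(x,M)<\eta\}$. A compact $\phi_-$-invariant set $M$ is asymptotically stable if (i) for every $\epsilon>0$ there is $\delta>0$ with $d(\phi_-(t,y),M)<\epsilon$ for all $t>0$ and $y\in\mathcal{N}_\delta(M)$, and (ii) there is $\eta>0$ with $\lim_{t\to\infty}d(\phi_-(t,y),M)=0$ for all $y\in\mathcal{N}_\eta(M)$. A nonautonomous set is a family $\mathcal{A}=\{A_t\}_{t\in\mathbb{R}}$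 of nonempty subsets of $\mathbb{R}^n$; it is invariant if $\Phi(t,s,A_s)=A_t$ for all $t,s$, compact if each $A_t$ is compact; its upper backward limit is $A_{-\infty}=\bigcap_{\tau>0}\overline{\bigcup_{t\le-\tau}A_t}$. A (local) pullback attractor is a compact invariant nonautonomous set $\mathcal{A}$ for which there exists a bounded open set $U$ containing $A_{-\infty}$ such that $\lim_{s\to-\infty}d(\Phi(t,s,U),A_t)=0$ for all $t\in\mathbb{R}$. *)

(* Defs.v *)
From HB Require Import structures.
From mathcomp Require Import all_boot all_order all_algebra.
From mathcomp Require Import all_classical all_reals.
From mathcomp Require Import ereal topology normedtype sequences derive.
Set Implicit Arguments. Unset Strict Implicit. Unset Printing Implicit Defensive.
Import Order.TTheory GRing.Theory Num.Theory.
Import numFieldNormedType.Exports.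
Local Open Scope classical_set_scope.
Local Open Scope ring_scope.

Section Defs.
Variables (R : realType) (n : nat).
Notation V := 'rV[R]_n.

(* f : R^n x R -> R^n is C^1: differentiable everywhere with continuous
   differential (continuity tested on each direction, finite dimension). *)
Definition C1 (f : V * R -> V) : Prop :=
  (forall z, differentiable f z) /\ (forall v : V * R, continuous (fun z => 'd f z v)).

Definition smooth (g : R -> R) : Prop :=
  forall k x, derivable (derive1n k g) x 1.

Definition parameter_shift (L : R -> R) (lm lp : R) : Prop :=
  [/\ smooth L, (forall t, lm < L t < lp),
      (L @ -oo --> lm /\ L @ +oo --> lp),
      (derive1 L) @ -oo --> (0:R) & (derive1 L) @ +oo --> (0:R)].

Definition dpt (x : V) (Y : set V) : \bar R :=
  ereal_inf [set ((`|x - y|)%:E) | y in Y].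
Definition dset (X Y : set V) : \bar R :=
  ereal_sup [set dpt x Y | x in X].
Definition nbhd_set (eta : R) (M : set V) : set V :=
  [set x | (dpt x M < eta%:E)%E].

Definition is_flow (g : V -> V) (phi : R -> V -> V) : Prop :=
  (forall y, phi 0 y = y) /\
  (forall t y, is_derive t (1:R) (fun s => phi s y) (g (phi t y))).

Definition is_cocycle (h : R -> V -> V) (Phi : R -> R -> V -> V) : Prop :=
  (forall s x0, Phi s s x0 = x0) /\
  (forall t s x0, is_derive t (1:R) (fun u => Phi u s x0) (h t (Phi t s x0))).

Definition flow_invariant (phi : R -> V -> V) (M : set V) : Prop :=
  forall t, phi t @` M = M.

Definition asymptotically_stable (phi : R -> V -> V) (M : set V) : Prop :=
  (forall eps : R, 0 < eps -> exists2 delta : R, 0 < delta &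
     forall t y, 0 < t -> nbhd_set delta M y -> (dset [set phi t y] M < eps%:E)%E)
  /\ (exists2 eta : R, 0 < eta & forall y, nbhd_set eta M y ->
       (fun t => dset [set phi t y] M) @ +oo --> 0%E).

Definition asymp_stable_attractor (phi : R -> V -> V) (M : set V) : Prop :=
  [/\ M !=set0, compact M, flow_invariant phi M & asymptotically_stable phi M].

Definition na_nonempty (A : R -> set V) : Prop := forall t, A t !=set0.
Definition na_invariant (Phi : R -> R -> V -> V) (A : R -> set V) : Prop :=
  forall t s, Phi t s @` A s = A t.
Definition na_compact (A : R -> set V) : Prop := forall t, compact (A t).

Definition upper_backward_limit (A : R -> set V) : set V :=
  \bigcap_(tau in [set tau : R | 0 < tau])
     closure (\bigcup_(t in [set t : R | t <= - tau]) A t).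

Definition local_pullback_attractor (Phi : R -> R -> V -> V) (A : R -> set V) : Prop :=
  [/\ na_nonempty A, na_compact A, na_invariant Phi A &
      exists U : set V, [/\ open U, bounded_set U,
        upper_backward_limit A `<=` U &
        forall t, (fun s => dset (Phi t s @` U) (A t)) @ -oo --> 0%E]].
End Defs.

(* Main.v *)
(** The flow of the past limit system attracts a closed neighbourhood of [Am]
uniformly (stability plus compactness).  Far in the past the nonautonomous
vector field is uniformly close to the autonomous one, so by a Gronwall
estimate [Phi] shadows [phim] on time windows of any fixed length.  Chaining
such windows shows that, for each [e], the cocycle eventually maps
[U := nbhd_set eta Am] into [nbhd_set e Am] and keeps it there up to some time
[S].  The pullback omega-limit sets of [U] then form the attractor. *)
Require Import Defs.
From HB Require Import structures.
From mathcomp Require Import all_boot all_order all_algebra.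
From mathcomp Require Import all_classical all_reals.
From mathcomp Require Import ereal topology normedtype sequences derive.
From mathcomp Require Import exp lra.
Set Implicit Arguments.
Unset Strict Implicit.
Unset Printing Implicit Defensive.
Import Order.TTheory GRing.Theory Num.Theory.
Import numFieldNormedType.Exports.
Local Open Scope classical_set_scope.
Local Open Scope ring_scope.

(** * Sup norm and derivatives through coordinates *)

Lemma coord_le_norm (R : realType) (n : nat) (x : 'rV[R]_n) (i : 'I_n) :
  `|x 0 i| <= `|x|.
Proof.
by rewrite [leRHS]mx_normrE; apply: (le_bigmax _ (fun ij => `|x ij.1 ij.2|) (0, i)).
Qed.

Lemma norm_lt_coord (R : realType) (n : nat) (x : 'rV[R]_n) (e : R) :
  0 < e -> (forall i, `|x 0 i| < e) -> `|x| < e.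
Proof.
move=> e0 xe; have [x0|/mx_norm_neq0[[i j] /= xij]] := eqVneq (mx_norm x) 0.
  by rewrite [ltLHS]x0.
by rewrite [ltLHS]xij ord1.
Qed.

Lemma norm_le_coord (R : realType) (n : nat) (x : 'rV[R]_n) (e : R) :
  0 <= e -> (forall i, `|x 0 i| <= e) -> `|x| <= e.
Proof.
move=> e0 xe; have [x0|/mx_norm_neq0[[i j] /= xij]] := eqVneq (mx_norm x) 0.
  by rewrite [leLHS]x0.
by rewrite [leLHS]xij ord1.
Qed.

Lemma is_derive_coord (R : realType) (n : nat) (w : R -> 'rV[R]_n) (t : R)
    (dw : 'rV[R]_n) (i : 'I_n) :
  is_derive t (1:R) w dw -> is_derive t (1:R) (fun u => w u 0 i : R) (dw 0 i).
Proof.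
move=> [dwt <-]; split; first exact: (derivable_mxP w t 1).1 dwt 0 i.
by rewrite (derive_mx dwt) mxE.
Qed.

Lemma is_derive_continuous (R : realType) (n : nat) (w : R -> 'rV[R]_n) (t : R)
    (dw : 'rV[R]_n) :
  is_derive t (1:R) w dw -> {for t, continuous w}.
Proof.
by case=> /derivable1_diffP /differentiable_continuous.
Qed.

(** * A Gronwall estimate *)

(** At the infimum of the counterexamples in [[s, T]] the step hypothesis gives [P], and openness
    gives it slightly beyond, which contradicts the infimum. *)
Lemma segment_induction (R : realType) (P : R -> Prop) (s T : R) :
  (forall t, P t -> \forall u \near t, P u) ->
  (forall t, s <= t <= T -> (forall u, s <= u < t -> P u) -> P t) ->
  forall t, s <= t <= T -> P t.
Proof.
move=> Popen Pstep t stT; apply: contrapT => nPt.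
pose Z := [set u : R | s <= u <= T /\ ~ P u].
have Zt : Z t by split.
have Zlb : lbound Z s by move=> u [] /andP[].
have Zinf : has_inf Z by split; [exists t|exists s].
have mlb : lbound Z (inf Z) by apply: ge_inf; exists s.
have sm : s <= inf Z by apply: lb_le_inf => //; exists t.
have mT : inf Z <= T by apply: le_trans (mlb _ Zt) _; case/andP: stT.
have /Popen : P (inf Z).
  apply: Pstep => [|u /andP[su um]]; first by rewrite sm.
  apply: contrapT => nPu; suff : inf Z <= u by rewrite leNgt um.
  by apply: mlb; split=> //; rewrite su (le_trans (ltW um)).
move=> /nbhs_ballP[e /= e0 eP].
have [z Zz zm] := inf_adherent e0 Zinf.
have := mlb _ Zz => mz; case: Zz => _; apply; apply: eP => /=.
by rewrite /ball/= ltr_distlC; lra.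
Qed.

(* The bound on [dw] is only needed while [w] is below the barrier
   [c * expR ((K + 1) * (t - s))], so it can come from a local Lipschitz
   estimate; no a priori bound on [w] is required. *)
Lemma gronwall_barrier (R : realType) (n : nat) (w dw : R -> 'rV[R]_n)
    (s T K d c : R) :
  0 <= K -> d <= c -> 0 < c ->
  (forall t, is_derive t (1:R) w (dw t)) -> `|w s| < c ->
  (forall t, s <= t <= T -> `|w t| <= c * expR ((K + 1) * (t - s)) ->
     `|dw t| <= K * `|w t| + d) ->
  forall t, s <= t <= T -> `|w t| < c * expR ((K + 1) * (t - s)).
Proof.
move=> K0 dc c0 wD ws Hdw.
pose E (t : R) : R := c * expR ((K + 1) * (t - s)).
have ED t : is_derive t (1:R) E ((K + 1) * E t).
  rewrite /E.
  have D1 : is_derive t (1:R) (fun t : R => (K + 1) * (t - s)) (K + 1).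
    have -> : (fun t : R => (K + 1) * (t - s)) = (K + 1) \*: (id - cst s).
      by apply/funext => u.
    by apply: is_derive_eq; rewrite subr0 /GRing.scale/= mulr1.
  have -> : (fun t : R => c * expR ((K + 1) * (t - s))) =
    c \*: (expR \o (fun t : R => (K + 1) * (t - s))) by apply/funext.
  by apply: is_derive_eq; rewrite /GRing.scale/=; lra.
have Ec t : {for t, continuous E}.
  by apply/differentiable_continuous/derivable1_diffP; case: (ED t).
have wc t : {for t, continuous w} by apply: is_derive_continuous (wD t).
apply: (@segment_induction _ (fun t => `|w t| < E t)) => t.
  move=> wEt.
  have h : {for t, continuous (fun u => E u - `|w u|)}.
    apply: cvgB; first exact: Ec.
    by apply: cvg_norm; exact: wc.
  have E0 : nbhs (E t - `|w t|) [set x | 0 < x] by apply: lt_nbhsr; lra.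
  have : \forall u \near t, 0 < E u - `|w u| by exact: (h _ E0).
  by apply: filterS => u /=; lra.
move=> /andP[st tT] IH.
have E0 u : 0 < E u by rewrite mulr_gt0// expR_gt0.
have Es : E s = c by rewrite /E subrr mulr0 expR0 mulr1.
have Ecge u : s <= u -> c <= E u.
  move=> su; rewrite /E -[leLHS]mulr1 ler_pM2l// -[leLHS]expR0 ler_expR.
  by apply: mulr_ge0; lra.
move: st; rewrite le_eqVlt => /orP[/eqP<-|st]; first by rewrite Es.
(* The norm need not be differentiable, so each coordinate is compared with the barrier
   separately. *)
apply: norm_lt_coord => // i.
(* Below the barrier, [K * E + d <= K * E + c <= (K + 1) * E] since [c <= E]; hence the growth rate
   [K + 1]. *)
have bound u : s < u < t -> `|dw u 0 i| <= (K + 1) * E u.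
  move=> /andP[su ut]; apply: le_trans (coord_le_norm _ _) _.
  have wEu : `|w u| < E u by apply: IH; lra.
  have dwu : `|dw u| <= K * `|w u| + d by apply: Hdw; [lra|exact: ltW].
  have := Ecge u (ltW su) => cEu.
  apply: le_trans dwu _.
  have ltw : K * `|w u| <= K * E u by rewrite ler_wpM2l// ltW.
  lra.
have wsi : `|w s 0 i| < E s by rewrite Es; apply: le_lt_trans (coord_le_norm _ _) ws.
have wiD u := is_derive_coord i (wD u).
(* By the mean value theorem, a function positive at [s] whose derivative is nonnegative strictly
   between [s] and [t] is positive at [t]. It is applied to the barrier plus and minus a coordinate
   of [w]. *)
have key (h dh : R -> R) : (forall u, is_derive u (1:R) h (dh u)) ->
    (forall u, s < u < t -> 0 <= dh u) -> 0 < h s -> 0 < h t.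
  move=> hD dh0 hs.
  have [|v vst vE] := MVT st (fun u _ => hD u).
    apply: derivable_within_continuous => v _; by case: (hD v).
  have : 0 <= dh v * (t - s) by apply: mulr_ge0; [apply: dh0|lra].
  by rewrite -vE; lra.
rewrite ltr_norml; apply/andP; split.
  have /key : forall u, is_derive u (1:R) (fun u => E u + w u 0 i) ((K + 1) * E u + dw u 0 i).
    by move=> u; apply: is_deriveD.
  move=> h; suff : 0 < E t + w t 0 i by lra.
  apply: h => [u /bound|]; first by rewrite ler_norml; lra.
  by move: wsi; rewrite ltr_norml; lra.
have /key : forall u, is_derive u (1:R) (fun u => E u - w u 0 i) ((K + 1) * E u - dw u 0 i).
  by move=> u; apply: is_deriveB.
move=> h; rewrite -subr_gt0.
apply: h => [u /bound|]; first by rewrite ler_norml; lra.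
by move: wsi; rewrite ltr_norml; lra.
Qed.

(** * Local Lipschitz bounds *)

Lemma bounded_setP (R : realType) (V : normedModType R) (A : set V) :
  bounded_set A <-> exists2 M : R, 0 < M & forall x, A x -> `|x| <= M.
Proof.
split=> [/pinfty_ex_gt0[M M0 AM]|[M M0 AM]]; first by exists M.
exists M; split; first exact: num_real.
by move=> N MN x /AM xM; apply: le_trans (ltW MN).
Qed.

Lemma continuous_bounded_on_compact (R : realType) (T : topologicalType)
    (V : normedModType R) (K : set T) (g : T -> V) :
  compact K -> continuous g ->
  exists2 M : R, 0 < M & forall z, K z -> `|g z| <= M.
Proof.
move=> cK cg; have : compact (g @` K).
  by apply: continuous_compact => //; apply: continuous_subspaceT.
move=> /compact_bounded/bounded_setP[M M0 KM]; exists M => // z Kz.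
by apply: KM; exists z.
Qed.

Lemma compact_norm_le (R : realType) (n : nat) (rho : R) :
  compact [set x : 'rV[R]_n | `|x| <= rho].
Proof.
apply: bounded_closed_compact.
  apply/bounded_setP; exists (Num.max 1 rho); first by rewrite lt_max ltr01.
  by move=> x /= xr; rewrite le_max xr orbT.
apply: (@preimage_closed _ _ (fun x : 'rV[R]_n => `|x|) [set y | y <= rho]).
  by move=> x _; exact: norm_continuous.
exact: closed_le.
Qed.

(** The only consequence of [C1] used for solutions; it survives negation of [f], hence time
    reversal. *)
Definition lipschitz_on_boxes (R : realType) (n : nat) (a b : R)
    (f : 'rV[R]_n * R -> 'rV[R]_n) : Prop :=
  forall rho : R, exists2 C : R, 0 < C & forall x y p q,
    `|x| <= rho -> `|y| <= rho -> a <= p <= b -> a <= q <= b ->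
    `|f (x, p) - f (y, q)| <= C * (`|x - y| + `|p - q|).

(** [C1] controls the differential one direction at a time; expanding [(h, k)] in the standard basis
    leaves finitely many directions, each bounded on the compact set. *)
Lemma differential_bounded_on_compact (R : realType) (n : nat)
    (f : 'rV[R]_n * R -> 'rV[R]_n) (K : set ('rV[R]_n * R)) :
  compact K -> C1 f ->
  exists2 C : R, 0 < C & forall z h k, K z -> `|'d f z (h, k)| <= C * (`|h| + `|k|).
Proof.
move=> cK [df dfc].
have bd v : exists M : R, 0 < M /\ forall z, K z -> `|'d f z v| <= M.
  by have [M M0 KM] := continuous_bounded_on_compact cK (dfc v); exists M.
have [M MP] := choice (fun j : 'I_n => bd ('e_j, 0)).
have [M' [M'0 M'P]] := bd (0, 1).
have M0 : 0 <= \sum_j M j by apply: sumr_ge0 => j _; case: (MP j) => /ltW.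
exists (\sum_j M j + M'); first lra.
move=> z h k Kz.
have -> : (h, k) = \sum_j h 0 j *: ('e_j, 0 : R) + k *: (0, 1).
  rewrite [RHS]surjective_pairing /=; congr pair.
    rewrite (big_morph fst (id1 := 0) (op1 := +%R))//= scaler0 addr0.
    exact: row_sum_delta.
  rewrite (big_morph snd (id1 := 0) (op1 := +%R))//= big1 ?add0r; last first.
    by move=> j _; rewrite scaler0.
  by rewrite /GRing.scale/= mulr1.
rewrite linearD linear_sum linearZ/=.
apply: le_trans (ler_normD _ _) _.
have h1 : `|\sum_j 'd f z (h 0 j *: ('e_j, 0 : R))| <= (\sum_j M j) * `|h|.
  apply: le_trans (ler_norm_sum _ _ _) _.
  rewrite mulr_suml; apply: ler_sum => j _.
  rewrite linearZ/= normrZ mulrC.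
  by apply: ler_pM => //; [case: (MP j) => _; apply|exact: coord_le_norm].
have h2 : `|k *: 'd f z (0, 1)| <= M' * `|k|.
  by rewrite normrZ mulrC ler_wpM2r// M'P.
apply: le_trans (lerD h1 h2) _.
have : 0 <= (\sum_j M j) * `|k| by apply: mulr_ge0.
have : 0 <= M' * `|h| by apply: mulr_ge0 => //; exact: ltW.
lra.
Qed.

Lemma is_derive_along_segment (R : realType) (U V : normedModType R) (f : U -> V)
    (z d : U) (t : R) :
  differentiable f (t *: d + z) ->
  is_derive t (1:R) (fun u : R => f (u *: d + z)) ('d f (t *: d + z) d).
Proof.
move=> dft.
have -> : (fun u : R => f (u *: d + z)) = f \o (( *:%R^~ d : R -> U) + cst z) by [].
have H1 : is_diff t (( *:%R^~ d : R -> U) + cst z) (( *:%R^~ d) + 0).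
  exact: is_diffD.
have H2 : is_diff ((( *:%R^~ d : R -> U) + cst z) t) f ('d f (t *: d + z)).
  by apply: DiffDef.
have [D E] := is_diff_comp H1 H2.
apply: DeriveDef; first by apply/derivable1_diffP.
by rewrite deriveE// E /= addr0 scale1r.
Qed.

(** The box is convex, so the mean value theorem applies along the segment between the two points;
    it is used coordinatewise, as it fails for vector values. *)
Lemma C1_lipschitz_on_boxes (R : realType) (n : nat) (a b : R)
    (f : 'rV[R]_n * R -> 'rV[R]_n) : C1 f -> lipschitz_on_boxes a b f.
Proof.
move=> fC1 rho.
pose K := [set x : 'rV[R]_n | `|x| <= rho] `*` `[a, b].
have cK : compact K.
  by apply: compact_setX; [exact: compact_norm_le|exact: segment_compact].
have [C C0 CP] := differential_bounded_on_compact cK fC1.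
exists C => // x y p q xr yr pab qab.
apply: norm_le_coord => [|i]; first by apply: mulr_ge0; [exact: ltW|exact: addr_ge0].
pose d := (x - y, p - q); pose z := (y, q).
pose g (u : R) := f (u *: d + z).
have gD u : is_derive u (1:R) g ('d f (u *: d + z) d).
  by apply: is_derive_along_segment; case: fC1.
have giD u := is_derive_coord i (gD u).
have [|v] := @MVT _ (fun u => g u 0 i) (fun u => 'd f (u *: d + z) d 0 i) 0 1 ltr01 (fun u _ => giD u).
  by apply: derivable_within_continuous => u _; case: (giD u).
rewrite in_itv/= => /andP[v0 v1]; rewrite subr0 mulr1.
have -> : g 1 = f (x, p) by rewrite /g scale1r /d /z; congr f; congr pair => /=; rewrite subrK.
have -> : g 0 = f (y, q) by rewrite /g scale0r add0r.
rewrite !mxE => ->; apply: le_trans (coord_le_norm _ _) _.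
apply: CP; split => /=.
  have -> : v *: (x - y) + y = v *: x + (1 - v) *: y.
    by rewrite scalerBr scalerBl scale1r addrAC addrA.
  apply: le_trans (ler_normD _ _) _; rewrite !normrZ !ger0_norm//; [|lra|lra].
  nra.
by rewrite in_itv /= /GRing.scale /=; apply/andP; split; nra.
Qed.

(** * Solutions and cocycles *)

(** The parameter path is arbitrary, so that a constant [p] covers the past limit system and
    [L (r * t)] the shifted one. *)
Definition solves (R : realType) (n : nat) (f : 'rV[R]_n * R -> 'rV[R]_n)
    (p : R -> R) (u : R -> 'rV[R]_n) : Prop :=
  forall t, is_derive t (1:R) u (f (u t, p t)).

Lemma is_derive_comp_affine (R : realType) (V : normedModType R) (w : R -> V)
    (k s t : R) (dw : V) :
  is_derive (t * k + s) (1:R) w dw ->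
  is_derive t (1:R) (fun u : R => w (u * k + s)) (k *: dw).
Proof.
move=> [/derivable1_diffP dft <-].
have := @is_derive_along_segment _ _ _ w s k t dft.
by rewrite deriveE// -linearZ/= /GRing.scale /= mulr1.
Qed.

Lemma solves_reverse (R : realType) (n : nat) (f : 'rV[R]_n * R -> 'rV[R]_n)
    (p : R -> R) (u : R -> 'rV[R]_n) :
  solves f p u -> solves (fun z => - f z) (fun t => p (- t)) (fun t => u (- t)).
Proof.
move=> us t.
have := @is_derive_comp_affine _ _ u (-1) 0 t _ (us _).
rewrite scaleN1r mulrN1 addr0.
by under [X in is_derive _ _ X _]funext => v do rewrite mulrN1 addr0.
Qed.

Lemma solves_shift (R : realType) (n : nat) (f : 'rV[R]_n * R -> 'rV[R]_n)
    (p : R -> R) (u : R -> 'rV[R]_n) (s : R) :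
  solves f p u -> solves f (fun t => p (t + s)) (fun t => u (t + s)).
Proof.
move=> us t.
have := @is_derive_comp_affine _ _ u 1 s t _ (us _).
rewrite scale1r mulr1.
by under [X in is_derive _ _ X _]funext => v do rewrite mulr1.
Qed.

Lemma lipschitz_on_boxesN (R : realType) (n : nat) (a b : R)
    (f : 'rV[R]_n * R -> 'rV[R]_n) :
  lipschitz_on_boxes a b f -> lipschitz_on_boxes a b (fun z => - f z).
Proof.
move=> Lf rho; have [C C0 CP] := Lf rho; exists C => // x y p q xr yr pab qab.
by rewrite -opprD normrN; exact: CP.
Qed.

(** Gronwall for [u - v], with the parameter gap as forcing. Only [v] needs an a priori bound: while
    the gap is at most 1, [u] lies in the ball of radius [rho], where the Lipschitz bound holds. *)
Lemma solutions_close (R : realType) (n : nat) (a b : R)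
    (f : 'rV[R]_n * R -> 'rV[R]_n) (p q : R -> R) (u v : R -> 'rV[R]_n)
    (rho C c s T : R) :
  0 < C -> 0 < c -> c * expR ((C + 1) * (T - s)) <= 1 ->
  (forall x y p q, `|x| <= rho -> `|y| <= rho -> a <= p <= b -> a <= q <= b ->
    `|f (x, p) - f (y, q)| <= C * (`|x - y| + `|p - q|)) ->
  (forall t, a <= p t <= b) -> (forall t, a <= q t <= b) ->
  solves f p u -> solves f q v ->
  (forall t, s <= t <= T -> `|v t| <= rho - 1) ->
  (forall t, s <= t <= T -> C * `|p t - q t| <= c) ->
  `|u s - v s| < c ->
  forall t, s <= t <= T -> `|u t - v t| < c * expR ((C + 1) * (t - s)).
Proof.
move=> C0 c0 cT lip pab qab us vs vrho pq uvs.
apply: (@gronwall_barrier R n (fun t => u t - v t)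
  (fun t => f (u t, p t) - f (v t, q t)) s T C c c (ltW C0)) => //.
  by move=> t; apply: is_deriveB.
move=> t stT uvt.
have uv1 : `|u t - v t| <= 1.
  apply: le_trans uvt (le_trans _ cT).
  rewrite ler_pM2l// ler_expR ler_pM2l; last lra.
  by case/andP: stT; lra.
have vr := vrho _ stT.
have ur : `|u t| <= rho.
  by rewrite -[u t](subrK (v t)); apply: le_trans (ler_normD _ _) _; lra.
have vr' : `|v t| <= rho by lra.
apply: le_trans (lip _ _ _ _ ur vr' (pab t) (qab t)) _.
by have := pq _ stT; lra.
Qed.

Lemma solution_bounded (R : realType) (n : nat) (f : 'rV[R]_n * R -> 'rV[R]_n)
    (p : R -> R) (v : R -> 'rV[R]_n) (s T : R) :
  solves f p v -> exists rho : R, forall t, s <= t <= T -> `|v t| <= rho.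
Proof.
move=> vs.
have vc : continuous v by move=> t; apply: is_derive_continuous (vs t).
have [M _ MP] := continuous_bounded_on_compact (@segment_compact R s T) vc.
by exists M => t stT; apply: MP; rewrite /= in_itv.
Qed.

Lemma forward_continuous_dependence (R : realType) (n : nat) (a b : R)
    (f : 'rV[R]_n * R -> 'rV[R]_n) (p : R -> R) (v : R -> 'rV[R]_n) (s t e : R) :
  lipschitz_on_boxes a b f -> (forall t, a <= p t <= b) -> solves f p v ->
  s <= t -> 0 < e ->
  exists2 c : R, 0 < c & forall u, solves f p u -> `|u s - v s| < c -> `|u t - v t| < e.
Proof.
move=> Lf pab vs st e0.
have [rho rhoP] := solution_bounded s t vs.
have [C C0 CP] := Lf (rho + 1).
have m0 : 0 < Num.min 1 e by rewrite lt_min ltr01.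
have E0 : 0 < expR ((C + 1) * (t - s)) by rewrite expR_gt0.
have cE : Num.min 1 e / expR ((C + 1) * (t - s)) * expR ((C + 1) * (t - s)) = Num.min 1 e.
  by rewrite divfK// gt_eqF.
(* The barrier then equals [Num.min 1 e] at time [t]: 1 keeps the solution in the Lipschitz ball,
   [e] is the target. *)
exists (Num.min 1 e / expR ((C + 1) * (t - s))); first by rewrite divr_gt0.
move=> u us uvs.
have := @solutions_close R n a b f p p u v (rho + 1) C _ s t C0 _ _ CP pab pab us vs _ _ uvs t.
rewrite cE lt_min => h.
suff /andP[] : (`|u t - v t| < 1) && (`|u t - v t| < e) by [].
apply: h; rewrite ?st ?lexx//.
- by rewrite divr_gt0.
- by rewrite ge_min lexx.
- by move=> x /rhoP; lra.
- by move=> x _; rewrite subrr normr0 mulr0 ltW// divr_gt0.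
Qed.

(** Backward in time, the forward case is applied to the reversed equation. *)
Lemma continuous_dependence (R : realType) (n : nat) (a b : R)
    (f : 'rV[R]_n * R -> 'rV[R]_n) (p : R -> R) (v : R -> 'rV[R]_n) (s t e : R) :
  lipschitz_on_boxes a b f -> (forall t, a <= p t <= b) -> solves f p v ->
  0 < e ->
  exists2 c : R, 0 < c & forall u, solves f p u -> `|u s - v s| < c -> `|u t - v t| < e.
Proof.
move=> Lf pab vs e0; have [st|/ltW ts] := leP s t.
  exact: forward_continuous_dependence Lf pab vs st e0.
have ts' : - s <= - t by rewrite lerN2.
have [c c0 cP] := forward_continuous_dependence
  (lipschitz_on_boxesN Lf) (fun t => pab (- t)) (solves_reverse vs) ts' e0.
exists c => // u us usv.
by have := cP _ (solves_reverse us); rewrite !opprK; exact.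
Qed.

Lemma solution_unique (R : realType) (n : nat) (a b : R)
    (f : 'rV[R]_n * R -> 'rV[R]_n) (p : R -> R) (u v : R -> 'rV[R]_n) (s : R) :
  lipschitz_on_boxes a b f -> (forall t, a <= p t <= b) ->
  solves f p u -> solves f p v -> u s = v s -> forall t, u t = v t.
Proof.
move=> Lf pab us vs uvs t; apply/eqP; rewrite -subr_eq0 -normr_le0.
apply/ler_addgt0Pr => e e0; rewrite add0r.
have [c c0 cP] := continuous_dependence s t Lf pab vs e0.
by apply/ltW/cP => //; rewrite uvs subrr normr0.
Qed.

(** Both sides solve the same equation and agree at time [u]. *)
Lemma cocycle_comp (R : realType) (n : nat) (a b : R)
    (f : 'rV[R]_n * R -> 'rV[R]_n) (p : R -> R) (Phi : R -> R -> 'rV[R]_n -> 'rV[R]_n) :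
  lipschitz_on_boxes a b f -> (forall t, a <= p t <= b) ->
  is_cocycle (fun t x => f (x, p t)) Phi ->
  forall t u s x, Phi t u (Phi u s x) = Phi t s x.
Proof.
move=> Lf pab [Phi0 PhiD] t u s x.
exact: (@solution_unique R n a b f p (fun t => Phi t u (Phi u s x)) (fun t => Phi t s x) u).
Qed.

Lemma cocycle_continuous (R : realType) (n : nat) (a b : R)
    (f : 'rV[R]_n * R -> 'rV[R]_n) (p : R -> R) (Phi : R -> R -> 'rV[R]_n -> 'rV[R]_n) :
  lipschitz_on_boxes a b f -> (forall t, a <= p t <= b) ->
  is_cocycle (fun t x => f (x, p t)) Phi ->
  forall t s, continuous (Phi t s).
Proof.
move=> Lf pab [Phi0 PhiD] t s x B /nbhs_ballP[e /= e0 eB].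
have Phis y : solves f p (fun t => Phi t s y) by move=> v; exact: PhiD.
have [c c0 cP] := continuous_dependence s t Lf pab (Phis x) e0.
apply/nbhs_ballP; exists c => //= y; rewrite -ball_normE /= => xy.
by apply: eB; rewrite -ball_normE /= distrC; apply: (cP _ (Phis y)); rewrite !Phi0 distrC.
Qed.

(** Through this, composition and continuity of cocycles apply to the limit flow. *)
Lemma flow_is_cocycle (R : realType) (n : nat) (f : 'rV[R]_n * R -> 'rV[R]_n) (a : R)
    (phi : R -> 'rV[R]_n -> 'rV[R]_n) :
  is_flow (fun x => f (x, a)) phi ->
  is_cocycle (fun=> fun x => f (x, a)) (fun t s => phi (t - s)).
Proof.
move=> [phi0 phiD]; split=> [s x|t s x]; first by rewrite subrr phi0.
exact: (@solves_shift R n f (fun=> a) (fun t => phi t x) (- s) (fun t => phiD t x) t).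
Qed.

(** * Uniform attraction *)

Lemma nbhd_setP (R : realType) (n : nat) (e : R) (M : set 'rV[R]_n) (x : 'rV[R]_n) :
  nbhd_set e M x <-> exists2 y, M y & `|x - y| < e.
Proof.
rewrite /nbhd_set /dpt /=; split=> [/ereal_inf_ltP[_ [y My <-]]|[y My xy]].
  by rewrite lte_fin; exists y.
by apply/ereal_inf_ltP; exists (`|x - y|)%:E; [exists y|rewrite lte_fin].
Qed.

Lemma dset1_lt (R : realType) (n : nat) (e : R) (M : set 'rV[R]_n) (x : 'rV[R]_n) :
  (dset [set x] M < e%:E)%E <-> nbhd_set e M x.
Proof. by rewrite /dset image_set1 ereal_sup1. Qed.

Lemma nbhd_set_le (R : realType) (n : nat) (e e' : R) (M : set 'rV[R]_n) :
  e <= e' -> nbhd_set e M `<=` nbhd_set e' M.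
Proof.
move=> ee x /nbhd_setP[y My xy]; apply/nbhd_setP; exists y => //.
exact: lt_le_trans ee.
Qed.

Lemma nbhd_set_triangle (R : realType) (n : nat) (e e' : R) (M : set 'rV[R]_n)
    (x y : 'rV[R]_n) :
  `|x - y| < e -> nbhd_set e' M y -> nbhd_set (e + e') M x.
Proof.
move=> xy /nbhd_setP[z Mz yz]; apply/nbhd_setP; exists z => //.
by apply: le_lt_trans (ler_distD y _ _) _; exact: ltrD.
Qed.

Lemma closure_normP (R : realType) (V : normedModType R) (A : set V) (x : V) :
  closure A x <-> forall e : R, 0 < e -> exists2 y, A y & `|x - y| < e.
Proof.
split=> [Ax e e0|H B /nbhs_ballP[e /= e0 eB]].
  have [y [Ay]] := Ax _ (nbhsx_ballx x e e0).
  by rewrite -ball_normE; exists y.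
by have [y Ay xy] := H e e0; exists y; split=> //; apply: eB; rewrite -ball_normE.
Qed.

Lemma closure_nbhd_set (R : realType) (n : nat) (e e' : R) (M : set 'rV[R]_n) :
  e < e' -> closure (nbhd_set e M) `<=` nbhd_set e' M.
Proof.
move=> ee x /closure_normP/(_ (e' - e))[|y My xy]; first lra.
by have := nbhd_set_triangle xy My; rewrite subrK.
Qed.

Lemma open_nbhd_set (R : realType) (n : nat) (e : R) (M : set 'rV[R]_n) :
  open (nbhd_set e M).
Proof.
rewrite openE => x /nbhd_setP[y My xy]; apply/nbhs_ballP.
exists (e - `|x - y|) => /=; first lra.
move=> z; rewrite -ball_normE /= => xz; apply/nbhd_setP; exists y => //.
by apply: le_lt_trans (ler_distD x _ _) _; rewrite (distrC z); lra.
Qed.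

Lemma subset_nbhd_set (R : realType) (n : nat) (e : R) (M : set 'rV[R]_n) :
  0 < e -> M `<=` nbhd_set e M.
Proof. by move=> e0 x Mx; apply/nbhd_setP; exists x; rewrite ?subrr ?normr0. Qed.

Lemma bounded_nbhd_set (R : realType) (n : nat) (e : R) (M : set 'rV[R]_n) :
  compact M -> bounded_set (nbhd_set e M).
Proof.
move=> /compact_bounded/bounded_setP[K K0 MK]; apply/bounded_setP.
exists (K + Num.max e 0); first by rewrite ltr_wpDr// le_max lexx orbT.
move=> x /nbhd_setP[y /MK yK xy]; rewrite -(subrK y x).
apply: le_trans (ler_normD _ _) _; rewrite addrC lerD// le_max.
by rewrite ltW.
Qed.

Lemma compact_closure_nbhd_set (R : realType) (n : nat) (e : R) (M : set 'rV[R]_n) :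
  compact M -> compact (closure (nbhd_set e M)).
Proof.
move=> cM; apply: bounded_closed_compact; last exact: closed_closure.
have /bounded_setP[K K0 KP] := bounded_nbhd_set (e + 1) cM.
apply/bounded_setP; exists K => // x /closure_nbhd_set Mx.
by apply/KP/Mx; lra.
Qed.

(** Each orbit from [K] enters the stability neighbourhood at some time; continuity carries nearby
    points along, stability keeps them close ever after, and compactness makes the time uniform. *)
Lemma uniform_attraction (R : realType) (n : nat) (phi : R -> 'rV[R]_n -> 'rV[R]_n)
    (M K : set 'rV[R]_n) (eta e : R) :
  (forall t, continuous (phi t)) ->
  (forall t s x, phi t (phi s x) = phi (t + s) x) ->
  asymptotically_stable phi M ->
  (forall y, nbhd_set eta M y -> (fun t => dset [set phi t y] M) @ +oo --> 0%E) ->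
  compact K -> K `<=` nbhd_set eta M -> 0 < e ->
  exists2 T : R, 0 < T & forall t y, T <= t -> K y -> nbhd_set e M (phi t y).
Proof.
move=> phic phiD [stab _] attr cK Keta e0.
have [d d0 dP] := stab _ e0.
have /compact_near_coveringP/(_ R +oo (fun t y => nbhd_set e M (phi t y))) := cK.
move=> /(_ _ _)[].
  move=> y Ky.
  have [T [_ TP]] : \forall t \near +oo, (dset [set phi t y] M < d%:E)%E.
    apply: (attr y (Keta y Ky) [set z | (z < d%:E)%E]).
    apply: open_nbhs_nbhs; split=> /=.
      exact: open_ereal_lt_ereal.
    by rewrite lte_fin.
  have My : nbhd_set d M (phi (T + 1) y) by apply/dset1_lt; apply: TP; lra.
  exists ([set x | nbhd_set d M (phi (T + 1) x)], [set t | T + 1 < t]).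
    split => /=; last by exists (T + 1); split=> //; exact: num_real.
    by apply: (phic (T + 1)); apply: open_nbhs_nbhs; split => //; exact: open_nbhd_set.
  (* The strict [T + 1 < t] makes the remaining time positive, as stability requires. *)
  move=> [x t] /= [Mx Tt]; apply/dset1_lt; rewrite -(subrK (T + 1) t) -phiD.
  by apply: dP => //; lra.
move=> T [_ TP]; exists (Num.max 1 (T + 1)).
  by rewrite lt_max ltr01.
by move=> t y; rewrite ge_max => /andP[_ Tt] Ky; apply: (TP t) => //; lra.
Qed.

(** The sets shrink as [c] decreases. A point of [K] lies in [N] or outside some [C c], and then has
    a neighbourhood missing all smaller ones; compactness gives one threshold. *)
Lemma antitone_compact_sub_open (R : realType) (T : topologicalType) (K N : set T)
    (C : R -> set T) :
  compact K -> open N -> (forall c, closed (C c)) ->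
  (forall c c', c <= c' -> C c `<=` C c') ->
  \bigcap_c C c `<=` N -> exists c0, forall c, c <= c0 -> K `&` C c `<=` N.
Proof.
move=> cK oN clC monoC CN.
have /compact_near_coveringP/(_ R -oo (fun c x => C c x -> N x)) := cK.
move=> /(_ _ _)[].
  move=> x Kx; have [Nx|nNx] := pselect (N x).
    exists (N, setT) => /=; last by move=> [y c] /= [].
    split; last exact: filterT.
    by apply: open_nbhs_nbhs.
  have [c nCx] : exists c, ~ C c x.
    by apply: contrapT => h; apply/nNx/CN => c _; apply: contrapT => ?; apply: h; exists c.
  exists (~` C c, [set c' | c' < c]) => /=.
    split; last by exists c; split=> //; exact: num_real.
    by apply: open_nbhs_nbhs; split=> //; exact: closed_openC.
  by move=> [y c'] /= [nCy cc'] Cy; case: nCy; apply: monoC Cy; exact: ltW.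
move=> c [_ cP]; exists (c - 1) => c' c'c x [Kx]; apply: (cP c') => //; lra.
Qed.

(** * Pullback limit sets *)

(** Nonemptiness of [X s] matters: the supremum over an empty set is [-oo], not 0. *)
Lemma dset_cvg0 (R : realType) (n : nat) (X : R -> set 'rV[R]_n) (Y : set 'rV[R]_n) :
  (forall s, X s !=set0) ->
  (forall e : R, 0 < e -> exists c, forall s, s <= c -> X s `<=` nbhd_set e Y) ->
  (fun s => dset (X s) Y) @ -oo --> 0%E.
Proof.
move=> X0 XY B nB.
have /nbhs_ballP[e /= e0 eB] : nbhs (0 : R) (fun x : R => B x%:E) := nB.
have [|c cP] := XY (e / 2); first lra.
exists c; split; first exact: num_real.
move=> s /ltW/cP XsY /=.
have d_ge0 : (0 <= dset (X s) Y)%E.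
  have [x Xx] := X0 s; apply: (@le_trans _ _ (dpt x Y)).
    by apply/ereal_infP => _ [y _ <-]; rewrite lee_fin.
  by apply: ereal_sup_ubound; exists x.
have d_le : (dset (X s) Y <= (e / 2)%:E)%E.
  by apply/ereal_supP => _ [x /XsY xY <-]; exact: ltW.
move: d_ge0 d_le; case: dset => // x; rewrite !lee_fin => x0 xe.
by apply: eB; rewrite -ball_normE /= sub0r normrN ger0_norm//; lra.
Qed.

Definition pullback_tail (R : realType) (n : nat) (Phi : R -> R -> 'rV[R]_n -> 'rV[R]_n)
    (U : set 'rV[R]_n) (t c : R) : set 'rV[R]_n :=
  closure (\bigcup_(s in [set s | s <= c]) (Phi t s @` U)).

(** The pullback analogue of an omega-limit set: starting times recede to [-oo] while the
    observation time [t] is fixed. *)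
Definition pullback_limit (R : realType) (n : nat) (Phi : R -> R -> 'rV[R]_n -> 'rV[R]_n)
    (U : set 'rV[R]_n) (t : R) : set 'rV[R]_n :=
  \bigcap_c pullback_tail Phi U t c.

Lemma sub_pullback_tail (R : realType) (n : nat) (Phi : R -> R -> 'rV[R]_n -> 'rV[R]_n)
    (U : set 'rV[R]_n) (t s c : R) :
  s <= c -> Phi t s @` U `<=` pullback_tail Phi U t c.
Proof. by move=> sc x Ux; apply: subset_closure; exists s. Qed.

(** Continuity pulls neighbourhoods back along [Phi t s], and composition keeps starting times, so
    limit sets are mapped into one another; the reverse inclusion uses the inverse [Phi s t]. *)
Lemma pullback_limit_invariant (R : realType) (n : nat)
    (Phi : R -> R -> 'rV[R]_n -> 'rV[R]_n) (U : set 'rV[R]_n) :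
  (forall s x, Phi s s x = x) -> (forall t u s x, Phi t u (Phi u s x) = Phi t s x) ->
  (forall t s, continuous (Phi t s)) -> na_invariant Phi (pullback_limit Phi U).
Proof.
move=> Phi0 PhiM Phic.
have sub t s x : pullback_limit Phi U s x -> pullback_limit Phi U t (Phi t s x).
  move=> Ax c _ B /Phic /(Ax c I) [_ [[u uc [y Uy <-]] /=]]; rewrite PhiM => By.
  by exists (Phi t u y); split=> //; exists u => //; exists y.
move=> t s; rewrite eqEsubset; split=> [_ [x Ax <-]|x Ax]; first exact: sub.
by exists (Phi s t x); [exact: sub|rewrite PhiM Phi0].
Qed.

(** All information on the limit system enters through [absorb], where [T] bounds the elapsed time
    from below and [S] the final time from above. *)
Section PullbackLimit.
Context (R : realType) (n : nat) (Phi : R -> R -> 'rV[R]_n -> 'rV[R]_n)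
  (M : set 'rV[R]_n) (eta : R).
Hypotheses (Phi0 : forall s x, Phi s s x = x)
  (PhiM : forall t u s x, Phi t u (Phi u s x) = Phi t s x)
  (Phic : forall t s, continuous (Phi t s))
  (cM : compact M) (M0 : M !=set0) (eta0 : 0 < eta)
  (absorb : forall e : R, 0 < e -> exists T S : R, forall t s y,
    s + T <= t -> t <= S -> nbhd_set eta M y -> nbhd_set e M (Phi t s y)).
Local Notation U := (nbhd_set eta M).
Local Notation A := (pullback_limit Phi U).

(** Orbits started in [U] no later than [S - T] are in [U] at time [S], so their values at [t] lie
    in the image of the compact [closure U] under [Phi t S], whether [t] is before or after [S]. *)
Lemma pullback_tail_compact (t : R) :
  exists2 K : set 'rV[R]_n, compact K &
    exists c0, forall c, c <= c0 -> pullback_tail Phi U t c `<=` K.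
Proof.
have [T [S TS]] := absorb eta0.
have cK : compact (Phi t S @` closure U).
  apply: continuous_compact; last exact: compact_closure_nbhd_set.
  by apply: continuous_subspaceT; exact: Phic.
exists (Phi t S @` closure U) => //; exists (S - T) => c cST.
have clK : closed (Phi t S @` closure U).
  by apply: compact_closed => //; exact: norm_hausdorff.
rewrite ((closure_id _).1 clK).
apply: closure_subset => _ [s /= sc [y Uy <-]].
exists (Phi S s y); last by rewrite PhiM.
by apply: subset_closure; apply: TS => //; lra.
Qed.

(** The tails eventually lie in a compact set and shrink to [A t], so they end up inside any open
    set containing it. *)
Lemma pullback_limit_attracts (t e : R) : 0 < e ->
  exists c, forall s, s <= c -> Phi t s @` U `<=` nbhd_set e (A t).
Proof.
move=> e0; have [K cK [c1 c1P]] := pullback_tail_compact t.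
have [||||c0 c0P] := @antitone_compact_sub_open R _ K (nbhd_set e (A t)) (pullback_tail Phi U t) cK.
- exact: open_nbhd_set.
- by move=> c; exact: closed_closure.
- move=> c c' cc'; apply: closure_subset => x [s /= sc Ux]; exists s => //=.
  exact: le_trans cc'.
- exact: subset_nbhd_set.
exists (Num.min c0 c1) => s; rewrite le_min => /andP[sc0 sc1] x Ux.
have xs := sub_pullback_tail (lexx s) Ux.
by apply: (c0P s sc0); split=> //; apply: c1P xs.
Qed.

(** Attraction with radius 1 puts an orbit value near some point of [A t]. *)
Lemma pullback_limit_nonempty : na_nonempty A.
Proof.
move=> t; have [c cP] := pullback_limit_attracts t ltr01.
have [y My] := M0.
have /nbhd_setP[z Az _] : nbhd_set 1 (A t) (Phi t c y).
  by apply: (cP c) => //; exists y => //; exact: subset_nbhd_set.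
by exists z.
Qed.

Lemma pullback_limit_compact : na_compact A.
Proof.
move=> t; have [K cK [c cP]] := pullback_tail_compact t.
apply: subclosed_compact cK _; last by move=> x /(_ c I); exact: cP.
by apply: closed_bigI => c' _; exact: closed_closure.
Qed.

(** Three errors of [e / 3]: from [x] to some [A t] with [t <= S], from there to an orbit value, and
    from that value to [M] by absorption; [M] is closed. *)
Lemma pullback_limit_backward : upper_backward_limit A `<=` M.
Proof.
move=> x ubx.
have clM : closed M by apply: compact_closed => //; exact: norm_hausdorff.
rewrite ((closure_id _).1 clM); apply/closure_normP => e e0.
have e3 : 0 < e / 3 by lra.
have [T [S TS]] := absorb e3.
(* The entry [- S] forces [t <= S]; the 1 ensures positivity. *)
have tau0 : 0 < Num.max 1 (- S) by rewrite lt_max ltr01.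
have /closure_normP/(_ _ e3)[z [t /= tS Az] xz] := ubx _ tau0.
have {}tS : t <= S by apply: le_trans tS _; rewrite lerNl le_max lexx orbT.
(* The tail up to [t - T] guarantees an elapsed time of at least [T]. *)
have /closure_normP/(_ _ e3)[_ [s /= sT [y Uy <-]] zy] := Az (t - T) I.
have Ny : nbhd_set (e / 3) M (Phi t s y) by apply: TS => //; lra.
have Nx := nbhd_set_triangle xz (nbhd_set_triangle zy Ny).
by apply/nbhd_setP; apply: nbhd_set_le Nx; lra.
Qed.

Lemma pullback_limit_attractor : local_pullback_attractor Phi A.
Proof.
split; [exact: pullback_limit_nonempty|exact: pullback_limit_compact|
  exact: pullback_limit_invariant|].
exists U; split; [exact: open_nbhd_set|exact: bounded_nbhd_set| |].
  by apply: subset_trans pullback_limit_backward _; exact: subset_nbhd_set.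
move=> t; apply: dset_cvg0 => [s|e e0]; last exact: pullback_limit_attracts.
have [y My] := M0.
by exists (Phi t s y); exists y => //; exact: subset_nbhd_set.
Qed.

End PullbackLimit.

(** * Shadowing of the past limit flow *)

(** Far in the past [p] is within [c / C] of [a], so the forcing is at most [c] whatever the
    starting time, and the barrier over a window of length [T] stays at most [Num.min 1 e]. *)
Lemma cocycle_close_to_flow (R : realType) (n : nat) (a b : R)
    (f : 'rV[R]_n * R -> 'rV[R]_n) (p : R -> R)
    (Phi : R -> R -> 'rV[R]_n -> 'rV[R]_n) (phi : R -> 'rV[R]_n -> 'rV[R]_n)
    (U : set 'rV[R]_n) (rho T e : R) :
  lipschitz_on_boxes a b f -> (forall t, a <= p t <= b) -> p @ -oo --> a ->
  is_cocycle (fun t x => f (x, p t)) Phi -> is_flow (fun x => f (x, a)) phi ->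
  (forall t y, 0 <= t -> U y -> `|phi t y| <= rho) -> 0 < e ->
  exists S, forall t s y, s <= t <= s + T -> t <= S -> U y ->
    `|Phi t s y - phi (t - s) y| < e.
Proof.
move=> Lf pab pa [Phi0 PhiD] fphi Urho e0.
have [psi0 psiD] := flow_is_cocycle fphi.
have [C C0 CP] := Lf (rho + 1).
have m0 : 0 < Num.min 1 e by rewrite lt_min ltr01.
have E0 : 0 < expR ((C + 1) * T) by rewrite expR_gt0.
pose c := Num.min 1 e / expR ((C + 1) * T).
have c0 : 0 < c by rewrite divr_gt0.
have cE : c * expR ((C + 1) * T) = Num.min 1 e by rewrite divfK// gt_eqF.
have cC0 : 0 < c / C by rewrite divr_gt0.
have aab : a <= a <= b by rewrite lexx; have := pab 0; lra.
have /cvgrPdist_lt/(_ _ cC0)[S [_ SP]] := pa.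
exists (S - 1) => t s y /andP[st tsT] tS Uy.
have barrier : c * expR ((C + 1) * (t - s)) <= Num.min 1 e.
  by rewrite -cE ler_pM2l// ler_expR ler_pM2l; lra.
have : `|Phi t s y - phi (t - s) y| < c * expR ((C + 1) * (t - s)).
  apply: (@solutions_close R n a b f p (fun=> a) (fun t => Phi t s y)
    (fun t => phi (t - s) y) (rho + 1) C c s t) => //.
  - by apply: le_trans barrier _; rewrite ge_min lexx.
  - by move=> u /andP[su _]; rewrite addrK; apply: Urho => //; lra.
  - move=> u /andP[_ ut]; rewrite mulrC -ler_pdivlMr// distrC ltW//.
    by apply: SP; lra.
  - by rewrite Phi0 psi0 subrr normr0.
  - by rewrite st lexx.
by move=> /lt_le_trans/(_ barrier); rewrite lt_min => /andP[].
Qed.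

(** Windows of length between [T] and [2 * T] are chained. Each ends within [m] of [M], where
    [m <= e] is the goal and [m <= eta] lets the next window start. *)
Lemma backward_absorbing (R : realType) (n : nat)
    (Phi : R -> R -> 'rV[R]_n -> 'rV[R]_n) (phi : R -> 'rV[R]_n -> 'rV[R]_n)
    (M : set 'rV[R]_n) (eta : R) :
  0 < eta -> (forall t u s x, Phi t u (Phi u s x) = Phi t s x) ->
  (forall T e : R, 0 < e -> exists S, forall t s y, s <= t <= s + T -> t <= S ->
     nbhd_set eta M y -> `|Phi t s y - phi (t - s) y| < e) ->
  (forall e : R, 0 < e -> exists2 T : R, 0 < T & forall t y, T <= t ->
     nbhd_set eta M y -> nbhd_set e M (phi t y)) ->
  forall e : R, 0 < e -> exists T S : R, forall t s y,
    s + T <= t -> t <= S -> nbhd_set eta M y -> nbhd_set e M (Phi t s y).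
Proof.
move=> eta0 PhiM close attr e e0.
pose m := Num.min e eta.
have m0 : 0 < m / 2 by rewrite divr_gt0// lt_min e0.
have [T T0 TP] := attr _ m0; have [S SP] := close (2 * T) _ m0.
exists T, S => t s y sTt tS Uy.
have base t' s' z : s' + T <= t' <= s' + 2 * T -> t' <= S -> nbhd_set eta M z ->
    nbhd_set m M (Phi t' s' z).
  move=> st' tS' Uz; rewrite [m]splitr; apply: (@nbhd_set_triangle _ _ _ _ _ _ (phi (t' - s') z)).
    by apply: SP => //; lra.
  by apply: TP => //; lra.
(* Induction on [k], which bounds the elapsed time by [k * T]; the case [k = 0] is void since [T] is
   positive. *)
have step k : forall t', s + T <= t' <= s + k%:R * T -> t' <= S -> nbhd_set m M (Phi t' s y).
  elim: k => [|k IH] t' st' tS'; first by move: st'; lra.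
  have [t2|t2] := leP t' (s + 2 * T); first by apply: base => //; lra.
  (* The last window has length exactly [T]; the time before it still exceeds [T]. *)
  rewrite -(PhiM _ (t' - T)); apply: base; [lra|by []|].
  apply: (@nbhd_set_le _ _ m); first by rewrite ge_min lexx orbT.
  by apply: IH; [move: st'; rewrite -natr1; lra|lra].
apply: (@nbhd_set_le _ _ m); first by rewrite ge_min lexx.
apply: (step (Num.bound ((t - s) / T))) => //; rewrite sTt /=.
have : (t - s) / T < (Num.bound ((t - s) / T))%:R.
  by apply: archi_boundP; apply: divr_ge0; lra.
by rewrite ltr_pdivrMr//; lra.
Qed.

(** * The attractor of the shifted system *)

Theorem theorem2p2 (R : realType) (n : nat)
  (f : 'rV[R]_n * R -> 'rV[R]_n) (lm lp : R) (L : R -> R) (r : R)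
  (Phi : R -> R -> 'rV[R]_n -> 'rV[R]_n) (phim : R -> 'rV[R]_n -> 'rV[R]_n)
  (Am : set 'rV[R]_n) :
  C1 f -> lm < lp -> parameter_shift L lm lp -> 0 < r ->
  is_cocycle (fun t x => f (x, L (r * t))) Phi ->
  is_flow (fun x => f (x, lm)) phim ->
  asymp_stable_attractor phim Am ->
  exists A : R -> set 'rV[R]_n,
    local_pullback_attractor Phi A /\ upper_backward_limit A `<=` Am.
Proof.
move=> fC1 lmlp [_ Lbd [Lm _] _ _] r0 cPhi fphi [Am0 cAm _ stab].
have Lf := C1_lipschitz_on_boxes lm lp fC1.
have pab t : lm <= L (r * t) <= lp by have := Lbd (r * t); lra.
have mab (t : R) : lm <= lm <= lp by rewrite lexx ltW.
have PhiM := cocycle_comp Lf pab cPhi.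
have Phic := cocycle_continuous Lf pab cPhi.
have cpsi := flow_is_cocycle fphi.
have phic t : continuous (phim t).
  (* Writing [t] as [t - 0] exhibits [phim t] as a value of the cocycle of the limit flow. *)
  rewrite -[t]subr0; move: t (0 : R).
  exact: (cocycle_continuous Lf mab cpsi).
have phiD t s x : phim t (phim s x) = phim (t + s) x.
  have := cocycle_comp Lf mab cpsi (t + s) s 0 x.
  by rewrite addrK !subr0.
clear mab.
have pm : (fun t => L (r * t)) @ -oo --> lm.
  move=> B /Lm [c [_ cB]]; exists (c / r); split; first exact: num_real.
  by move=> t; rewrite ltr_pdivlMr// mulrC => /cB.
have [stab1 [eta eta0 attr]] := stab.
have [d d0 dP] := stab1 1 ltr01.
(* The bounds 1 and [d] keep forward orbits from [nbhd_set eta' Am] within distance 1 of [Am], hence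
   bounded; [eta / 2] puts its closure in the region of attraction. *)
pose eta' := Num.min (Num.min 1 d) (eta / 2).
have eta'0 : 0 < eta' by rewrite !lt_min ltr01 d0 divr_gt0.
have eta'1 : eta' <= 1 by rewrite !ge_min lexx.
have eta'd : eta' <= d by rewrite !ge_min lexx orbT.
have eta'2 : eta' <= eta / 2 by rewrite !ge_min lexx orbT.
have eta'eta : eta' < eta by lra.
have /bounded_setP[rho rho0 rhoP] := bounded_nbhd_set 1 cAm.
have Urho t y : 0 <= t -> nbhd_set eta' Am y -> `|phim t y| <= rho.
  (* Stability speaks of [0 < t] only, so time 0 is treated apart. *)
  move=> t0 Uy; apply: rhoP; move: t0; rewrite le_eqVlt => /orP[/eqP<-|t0].
    by case: fphi => -> _; apply: nbhd_set_le Uy.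
  by apply/dset1_lt/dP => //; apply: nbhd_set_le Uy.
have close T e := @cocycle_close_to_flow _ _ _ _ _ _ _ _ _ _ T e
  Lf pab pm cPhi fphi Urho.
have uattr (e : R) : 0 < e -> exists2 T : R, 0 < T & forall t y, T <= t ->
    nbhd_set eta' Am y -> nbhd_set e Am (phim t y).
  move=> e0.
  have Ksub : closure (nbhd_set eta' Am) `<=` nbhd_set eta Am.
    exact: closure_nbhd_set.
  have [T T0 TP] := uniform_attraction phic phiD stab attr
    (compact_closure_nbhd_set cAm) Ksub e0.
  by exists T => // t y Tt Uy; apply: TP => //; exact: subset_closure.
have absorb := backward_absorbing eta'0 PhiM close uattr.
have Phi0 : forall s x, Phi s s x = x by case: cPhi.
exists (pullback_limit Phi (nbhd_set eta' Am)); split.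
  exact: pullback_limit_attractor.
exact: pullback_limit_backward.
Qed.
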